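(* For no fixed positive integers $k$ and $m$ is the permanent family $(\mathrm{PER}_n)_n$ in the class $\mathrm{mSPS}(k,m)$. That is, there do not exist a polynomial $Q$ and, for each $n$, polynomials $f_{1n},\dots,f_{mn}$ in the $n^2$ variables $X_{ab}$ and non-negative integers $\alpha_{ij}$ ($1\le i\le k$, $1\le j\le m$) such that for all $n$: (i) $\mathrm{PER}_n$ depends on at most $Q(n)$ variables; (ii) $\mathrm{PER}_n(\vec X)=\sum_{i=1}^k\prod_{j=1}^m f_{jn}^{\alpha_{ij}}(\vec X)$; (iii) the bitsize of each $\alpha_{ij}$ is at most $Q(n)$; (iv) each $f_{jn}$ is computed by a constant-free arithmetic circuit of size at most $Q(n)$ and is $Q(n)$-sparse.
   Context: The permanent over $n^2$ variables is $\mathrm{PER}_n=\sum_{\sigma\in\Sigma_n}\prod_{i=1}^n X_{i\sigma(i)}$, where $\Sigma_n$ is the set of permutations of $\{1,\dots,n\}$. A polynomial is $s$-sparse if it has at most $s$ monomials. A constant-free arithmetic circuit is an arithmetic circuit with addition, subtraction and multiplication gates whose inputs are variables and no constants other than $-1$ (equivalently, only integer constants obtainable from it). The class $\mathrm{mSPS}(k,m)$ is the class of polynomial families $(P_n)$ for which there is a polynomial $Q$ such that conditions (i)–(iv) above hold with $P_n$ in place of $\mathrm{PER}_n$ (the exponents $\alpha_{ij}$ may depend on $n$). *)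

(* Defs.v *)
From HB Require Import structures.
From mathcomp Require Import all_boot all_order all_fingroup all_algebra.
From mathcomp Require Export mpoly.

Set Implicit Arguments.
Unset Strict Implicit.
Unset Printing Implicit Defensive.

Import Order.TTheory GRing.Theory Num.Theory.
Local Open Scope ring_scope.

(* The variable X_ab is 'X_(mxvec_index a b), where mxvec_index is the
   row-major bijection 'I_n * 'I_n -> 'I_(n * n). *)
Definition PER (n : nat) : {mpoly int[n * n]} :=
  \sum_(s : 'S_n) \prod_(i < n) 'X_(mxvec_index i (s i)).

Section Polynomials.
Variable v : nat.

Definition vars (p : {mpoly int[v]}) : {set 'I_v} :=
  [set i | has (fun mon : 'X_{1..v} => mon i != 0%N) (msupp p)].

Definition sparse (s : int) (p : {mpoly int[v]}) : Prop :=
  (size (msupp p))%:Z <= s.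

(* A circuit is listed in topological order: the operands of an arithmetic
   gate are the positions in the list of earlier gates, so that gates can be
   reused (unbounded fan-out). *)
Inductive gate : Type :=
| Input of 'I_v
| MinusOne
| Add of nat & nat
| Sub of nat & nat
| Mul of nat & nat.

Definition circuit := seq gate.

Definition gate_wf (pos : nat) (g : gate) : bool :=
  match g with
  | Input _ | MinusOne => true
  | Add a b | Sub a b | Mul a b => (a < pos)%N && (b < pos)%N
  end.

Definition circuit_wf (c : circuit) : Prop :=
  forall pos : nat, (pos < size c)%N -> gate_wf pos (nth MinusOne c pos).

Definition gate_val (vals : seq {mpoly int[v]}) (g : gate) : {mpoly int[v]} :=
  match g with
  | Input i => 'X_i
  | MinusOne => -1
  | Add a b => vals`_a + vals`_b
  | Sub a b => vals`_a - vals`_b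
  | Mul a b => vals`_a * vals`_b
  end.

Definition circuit_vals (c : circuit) : seq {mpoly int[v]} :=
  foldl (fun vals g => rcons vals (gate_val vals g)) [::] c.

(* Any gate may serve as the output gate. *)
Definition computes (c : circuit) (p : {mpoly int[v]}) : Prop :=
  circuit_wf c /\
  exists2 out : nat, (out < size c)%N & (circuit_vals c)`_out = p.

(* The size of a circuit is its number of gates, inputs included. *)
Definition circuit_size (c : circuit) : nat := size c.

End Polynomials.

(* Number of binary digits; 0 has one digit. *)
Definition bitsize (a : nat) : nat := (trunc_log 2 a).+1.

Definition mSPS (k m : nat) (v : nat -> nat)
    (P : forall n : nat, {mpoly int[v n]}) : Prop :=
  exists Q : {poly int}, forall n : nat, (0 < n)%N ->
  exists (f : 'I_m -> {mpoly int[v n]}) (alpha : 'I_k -> 'I_m -> nat),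
    [/\ #|vars (P n)|%:Z <= Q.[n%:Z],
        P n = \sum_(i < k) \prod_(j < m) f j ^+ alpha i j,
        forall i j, (bitsize (alpha i j))%:Z <= Q.[n%:Z]
      & forall j,
          (exists2 c : circuit (v n),
             computes c (f j) & (circuit_size c)%:Z <= Q.[n%:Z])
          /\ sparse Q.[n%:Z] (f j)].

(* Main.v *)
(* If the permanent of size n + 1 is a polynomial in f_1, ..., f_m, then
   substituting 1 on and below the diagonal, y_i in position (i, i + 1) and 0
   elsewhere shows that P = (1 + y_1) ... (1 + y_n) is a polynomial in m
   polynomials that are at least as sparse. By the chain rule the gradient of P
   lies in the row space of the Jacobian matrix of these polynomials. Let D be
   a nonzero minor of maximal size of that matrix. For a column x outside D,
   the minor bordered by x and by the gradient of P vanishes, so D dP/dx is a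
   combination of the dP/dz with z a column of D. At y_x = -1 each such dP/dz
   vanishes and dP/dx does not, hence D vanishes there. A nonzero polynomial
   vanishing at y_x = -1 for at least n - m variables x has at least 2^(n - m)
   monomials, whereas D has at most m! s^m of them if each f_j is s-sparse. *)
Require Import Defs.
From HB Require Import structures.
From mathcomp Require Import all_boot all_order all_fingroup all_algebra.
From mathcomp Require Import zify.

Set Implicit Arguments.
Unset Strict Implicit.
Unset Printing Implicit Defensive.

Import Order.TTheory GRing.Theory Num.Theory.

(** * Number of monomials under ring operations, derivatives and determinants *)

Section Sparsity.
Local Open Scope ring_scope.
Variables (R : idomainType) (n : nat).
Implicit Types p q : {mpoly R[n]}.

Lemma size_msupp1 : size (msupp (1 : {mpoly R[n]})) = 1%N.
Proof. by rewrite -mpolyC1 msupp1. Qed.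

Lemma size_msuppD p q :
  (size (msupp (p + q)) <= size (msupp p) + size (msupp q))%N.
Proof.
rewrite -size_cat; apply: uniq_leq_size (msupp_uniq _) _.
exact: msuppD_le.
Qed.

Lemma size_msuppM p q :
  (size (msupp (p * q)) <= size (msupp p) * size (msupp q))%N.
Proof.
rewrite -(size_allpairs (fun a b : 'X_{1..n} => (a + b)%MM)).
exact: uniq_leq_size (msupp_uniq _) (@msuppM_le _ _ p q).
Qed.

Lemma size_msupp_sum (I : Type) (s : seq I) (P : pred I) F :
  (size (msupp (\sum_(i <- s | P i) F i : {mpoly R[n]})) <=
   \sum_(i <- s | P i) size (msupp (F i)))%N.
Proof.
apply: (big_ind2 (fun p (k : nat) => size (msupp p) <= k)%N) => //.
  by rewrite -mpolyC0 msupp0.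
move=> p k q l hp hq; exact: leq_trans (size_msuppD _ _) (leq_add hp hq).
Qed.

Lemma size_msupp_prod (I : Type) (s : seq I) (P : pred I) F :
  (size (msupp (\prod_(i <- s | P i) F i : {mpoly R[n]})) <=
   \prod_(i <- s | P i) size (msupp (F i)))%N.
Proof.
apply: (big_ind2 (fun p (k : nat) => size (msupp p) <= k)%N) => //.
  by rewrite size_msupp1.
move=> p k q l hp hq; exact: leq_trans (size_msuppM _ _) (leq_mul hp hq).
Qed.

Lemma size_msuppX_le1 p k :
  (size (msupp p) <= 1)%N -> (size (msupp (p ^+ k)) <= 1)%N.
Proof.
move=> hp; elim: k => [|k IH]; first by rewrite expr0 size_msupp1.
by rewrite exprS; apply: leq_trans (size_msuppM _ _) (leq_mul hp IH).
Qed.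

Lemma size_msuppC (c : R) : (size (msupp (c%:MP : {mpoly R[n]})) <= 1)%N.
Proof. by rewrite msuppC; case: ifP. Qed.

Lemma size_msupp_mderiv i p : (size (msupp p^`M(i)) <= size (msupp p))%N.
Proof.
have -> : size (msupp p) = size [seq (m - U_(i))%MM | m <- msupp p].
  by rewrite size_map.
apply: uniq_leq_size (msupp_uniq _) _ => m; rewrite mcoeff_msupp mcoeff_deriv.
move=> nz; apply/mapP; exists (m + U_(i))%MM; last by rewrite addmK.
by rewrite mcoeff_msupp; apply: contraNneq nz => ->; rewrite mul0rn.
Qed.

Lemma size_msupp_det (d B : nat) (A : 'M[{mpoly R[n]}]_d) :
  (forall i j, (size (msupp (A i j)) <= B)%N) ->
  (size (msupp (\det A)) <= d`! * B ^ d)%N.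
Proof.
move=> hA; apply: leq_trans (size_msupp_sum _ _ _) _.
rewrite -card_Sn -sum_nat_const; apply: leq_sum => s _.
apply: leq_trans (size_msuppM _ _) _.
rewrite -[X in (_ <= X)%N]mul1n; apply: leq_mul.
  by rewrite -signr_odd; case: odd; rewrite ?expr1 ?expr0 ?size_msupp1 //
             (perm_size (msuppN _)) size_msupp1.
apply: leq_trans (size_msupp_prod _ _ _) _.
rewrite -[X in (_ <= _ ^ X)%N]card_ord -prod_nat_const.
by apply: leq_prod => i _.
Qed.

End Sparsity.

(** * Substitution of single terms for the variables *)

Section Substitution.
Local Open Scope ring_scope.
Variables (R : idomainType) (n n' : nat) (h : 'I_n -> {mpoly R[n']}).

(** A product of powers of terms is again a term or zero, so each monomial of [p] contributes at
    most one monomial. *)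
Lemma size_msupp_subst (p : {mpoly R[n]}) :
  (forall i, (size (msupp (h i)) <= 1)%N) ->
  (size (msupp (mmap (@mpolyC n' R) h p)) <= size (msupp p))%N.
Proof.
move=> hh; apply: leq_trans (size_msupp_sum _ _ _) _.
rewrite -sum1_size; apply: leq_sum => m _.
apply: leq_trans (size_msuppM _ _) _.
rewrite -[X in (_ <= X)%N]mul1n; apply: leq_mul (size_msuppC _ _) _.
apply: leq_trans (size_msupp_prod _ _ _) _.
by apply: (big_ind (fun k : nat => k <= 1)%N) => // [[|[]] [|[]]|i _] //;
   apply: size_msuppX_le1.
Qed.

End Substitution.

(** * Sparsity of polynomials vanishing at -1 in many variables *)

Section VanishingAtMinusOne.
Local Open Scope ring_scope.
Variables (R : idomainType) (n : nat).

Definition drop_var (x : 'I_n) (m : 'X_{1..n}) : 'X_{1..n} :=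
  [multinom if i == x then 0%N else m i | i < n].

Definition at_minus1 (x : 'I_n) : {mpoly R[n]} -> {mpoly R[n]} :=
  mmap (@mpolyC n R) (fun i => if i == x then -1 else 'X_i).

HB.instance Definition _ x := GRing.RMorphism.on (at_minus1 x).

Lemma at_minus1X x i :
  at_minus1 x 'X_i = if i == x then -1 else 'X_i.
Proof. by rewrite /at_minus1 mmapX mmap1U. Qed.

(** Monomials differing only in their exponent of [x] collapse to one. This turns vanishing at -1
    into linear conditions on the coefficients, which make sense on any list of monomials and so
    suit an induction. *)
Lemma mcoeff_at_minus1 x (p : {mpoly R[n]}) m0 :
  (at_minus1 x p)@_m0 =
  \sum_(m <- msupp p | drop_var x m == m0) (-1) ^+ m x * p@_m.
Proof.
rewrite /at_minus1 /mmap raddf_sum [RHS]big_mkcond; apply: eq_bigr => m _ /=.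
have -> : mmap1 (fun i => if i == x then -1 else 'X_i) m
          = (-1) ^+ m x *: 'X_[drop_var x m] :> {mpoly R[n]}.
  rewrite /mmap1 (bigD1 x) //= eqxx mpolyXE_id [in RHS](bigD1 x) //=.
  rewrite mnmE eqxx expr0 mul1r -mul_mpolyC rmorphXn rmorphN1; congr (_ * _).
  by apply: eq_bigr => i /negPf ix; rewrite ix mnmE ix.
rewrite mcoeffCM mcoeffZ mcoeffX; case: eqP => _.
  by rewrite mulr1 mulrC.
by rewrite !mulr0.
Qed.

(* Splitting the monomials by their degree in one variable [x] of [S] preserves
   the vanishing conditions at the other variables of [S], and vanishing at
   [x] forces at least two degrees to occur. *)
Lemma size_vanishing_support (S : {set 'I_n}) (c : 'X_{1..n} -> R)
    (s : seq 'X_{1..n}) :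
  uniq s -> s != [::] -> {in s, forall m, c m != 0} ->
  {in S, forall x m0,
    \sum_(m <- s | drop_var x m == m0) (-1) ^+ m x * c m = 0} ->
  (2 ^ #|S| <= size s)%N.
Proof.
have [k] := ubnP #|S|; elim: k => // k IH in S s *.
rewrite ltnS => Sk us ns cs van.
have [->|[x xS]] := set_0Vmem S; first by rewrite cards0 lt0n size_eq0.
have [m ms] : exists m, m \in s.
  by case: s ns {us cs van} => // m s; exists m; rewrite mem_head.
(* If all degrees in [x] agreed, [m] would be the only monomial of [s] above [drop_var x m], and the
   vanishing sum would be [c m] up to sign. *)
have [m' m's m'x] : exists2 m', m' \in s & m' x != m x.
  apply/hasP; apply: contraT; rewrite -all_predC => /allP same.
  have := van _ xS (drop_var x m); rewrite -big_filter.
  have -> : [seq i <- s | drop_var x i == drop_var x m] = [:: m].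
    apply: perm_small_eq => //; apply: uniq_perm; rewrite ?filter_uniq //.
    move=> u; rewrite mem_filter inE; apply/andP/eqP => [[/eqP e us']|->//].
    apply/mnmP => i; have := congr1 (fun v : 'X_{1..n} => v i) e; rewrite !mnmE.
    by case: eqP => [-> _|//]; have := same _ us'; rewrite /= negbK => /eqP.
  by rewrite big_seq1 => /eqP; rewrite mulf_eq0 signr_eq0 (negPf (cs _ ms)).
have half u : u \in s ->
    (2 ^ #|S|.-1 <= size [seq v : 'X_{1..n} <- s | v x == u x])%N.
  move=> us'; have -> : #|S|.-1 = #|S :\ x| by rewrite (cardsD1 x S) xS.
  apply: IH; rewrite ?filter_uniq //.
  - by rewrite (cardsD1 x S) xS in Sk.
  - by apply/eqP => e; have := in_nil u; rewrite -e mem_filter us' eqxx.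
  - by move=> v; rewrite mem_filter => /andP[_]; apply: cs.
  move=> y; rewrite !inE => /andP[yx yS] m0; rewrite big_filter_cond.
  have [m0u|m0u] := eqVneq (m0 x) (u x).
    rewrite -[RHS](van _ yS m0); apply: eq_bigl => v.
    case: (drop_var y v =P m0) => [e|]; last by rewrite andbF.
    have := congr1 (fun v : 'X_{1..n} => v x) e.
    by rewrite mnmE eq_sym (negPf yx) => ->; rewrite m0u eqxx.
  rewrite big1 // => v /andP[/eqP vu /eqP e]; case/eqP: m0u.
  by rewrite -vu -e mnmE eq_sym (negPf yx).
have -> : #|S| = #|S|.-1.+1 by rewrite (cardsD1 x S) xS.
rewrite expnS mul2n -addnn.
apply: leq_trans (leq_add (half _ ms) (half _ m's)) _.
rewrite !size_filter -(count_predC (fun v : 'X_{1..n} => v x == m x) s).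
rewrite leq_add2l.
by apply: sub_count => v /= /eqP->.
Qed.

Lemma size_msupp_vanishing (S : {set 'I_n}) (p : {mpoly R[n]}) :
  p != 0 -> {in S, forall x, at_minus1 x p = 0} ->
  (2 ^ #|S| <= size (msupp p))%N.
Proof.
move=> nzp van; apply: (@size_vanishing_support S (fun m => p@_m)).
- exact: msupp_uniq.
- by rewrite msupp_eq0.
- by move=> m; rewrite mcoeff_msupp.
by move=> x xS m0; rewrite -mcoeff_at_minus1 van // mcoeff0.
Qed.

End VanishingAtMinusOne.

(** * Gradients in the row space of the Jacobian matrix *)

Section Jacobian.
Local Open Scope ring_scope.
Variables (R : idomainType) (n m : nat) (f : 'I_m -> {mpoly R[n]}).

(** With the coefficients [c] left existential, the chain rule reduces to closure under sums and
    products, and no outer polynomial has to be differentiated. *)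
Definition gradient_spanned (p : {mpoly R[n]}) :=
  exists c : 'I_m -> {mpoly R[n]},
  forall x, p^`M(x) = \sum_i c i * (f i)^`M(x).

Lemma gradient_spanned0 : gradient_spanned 0.
Proof.
exists (fun=> 0) => x; rewrite mderiv0 big1 // => i _; exact: mul0r.
Qed.

Lemma gradient_spanned1 : gradient_spanned 1.
Proof.
exists (fun=> 0) => x; rewrite -mpolyC1 mderivC big1 // => i _; exact: mul0r.
Qed.

Lemma gradient_spanned_gen i : gradient_spanned (f i).
Proof.
exists (fun j => (j == i)%:R) => x; rewrite (bigD1 i) //= eqxx mul1r.
by rewrite big1 ?addr0 // => j /negPf->; rewrite mul0r.
Qed.

Lemma gradient_spannedD p q :
  gradient_spanned p -> gradient_spanned q -> gradient_spanned (p + q).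
Proof.
move=> [c hc] [d hd]; exists (fun i => c i + d i) => x.
by rewrite mderivD hc hd -big_split /=; apply: eq_bigr => i _; rewrite mulrDl.
Qed.

Lemma gradient_spannedM p q :
  gradient_spanned p -> gradient_spanned q -> gradient_spanned (p * q).
Proof.
move=> [c hc] [d hd]; exists (fun i => c i * q + p * d i) => x.
rewrite mderivM hc hd mulr_suml mulr_sumr -big_split /=.
by apply: eq_bigr => i _; rewrite mulrDl -!mulrA [q * _]mulrC.
Qed.

Lemma gradient_spanned_sum_prod k (alpha : 'I_k -> 'I_m -> nat) :
  gradient_spanned (\sum_(i < k) \prod_(j < m) f j ^+ alpha i j).
Proof.
apply: (big_ind gradient_spanned) => [||i _].
- exact: gradient_spanned0.
- exact: gradient_spannedD.
apply: (big_ind gradient_spanned) => [||j _].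
- exact: gradient_spanned1.
- exact: gradient_spannedM.
elim: (alpha i j) => [|a IH]; first exact: gradient_spanned1.
by rewrite exprS; apply: gradient_spannedM IH; apply: gradient_spanned_gen.
Qed.

Definition jacobian : 'M[{mpoly R[n]}]_(m, n) := \matrix_(i, x) (f i)^`M(x).

End Jacobian.

(** * Nonzero minors of maximal size *)

Section Minors.
Local Open Scope ring_scope.
Variables (A : comNzRingType) (m n : nat) (J : 'M[A]_(m, n)).

(** Arbitrary index maps are allowed, since a repeated row or column makes the minor zero. *)
Definition nonzero_minor (d : nat) : bool :=
  [exists g : {ffun 'I_d -> 'I_m}, exists h : {ffun 'I_d -> 'I_n},
    \det (mxsub g h J) != 0].

Lemma nonzero_minor0 : nonzero_minor 0.
Proof.
apply/existsP; exists (ffun0 (card_ord 0)).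
by apply/existsP; exists (ffun0 (card_ord 0)); rewrite det_mx00 oner_neq0.
Qed.

Lemma nonzero_minor_le d : nonzero_minor d -> (d <= m)%N.
Proof.
move=> /existsP[g /existsP[h nz]]; rewrite leqNgt; apply: contra nz => lt_md.
have /injectivePn[i [j ij gij]] : ~~ injectiveb g.
  apply/injectiveP => /leq_card; by rewrite !card_ord leqNgt lt_md.
by apply/eqP/(determinant_alternate ij) => x; rewrite !mxE gij.
Qed.

Definition border (T : Type) d (t : T) (g : 'I_d -> T) (i : 'I_d.+1) : T :=
  oapp g t (unlift ord0 i).

Lemma border0 T d t (g : 'I_d -> T) : border t g ord0 = t.
Proof. by rewrite /border unlift_none. Qed.

Lemma border_lift T d t (g : 'I_d -> T) i : border t g (lift ord0 i) = g i.
Proof. by rewrite /border liftK. Qed.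

(* The bordered determinant is linear in its first row, and replacing that row
   by a row of [J] gives a minor of [J] of size [d.+1], which vanishes. *)
Lemma maximal_minor_relation (c : 'I_m -> A) (w : 'I_n -> A) :
  (forall x, w x = \sum_k c k * J k x) ->
  exists d (g : 'I_d -> 'I_m) (h : 'I_d -> 'I_n),
  [/\ (d <= m)%N, \det (mxsub g h J) != 0 &
   forall x, exists e : 'I_d -> A,
     w x * \det (mxsub g h J) = \sum_j w (h j) * e j].
Proof.
move=> hw.
have [d /existsP[g /existsP[h nz]] dmax] :=
  ex_maxnP (ex_intro _ 0%N nonzero_minor0) nonzero_minor_le.
exists d, g, h; split=> // [|x].
  by apply: nonzero_minor_le; apply/existsP; exists g; apply/existsP; exists h.
pose M (r : 'I_n -> A) : 'M[A]_d.+1 :=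
  \matrix_(i, j) border r (fun i => J (g i)) i (border x h j).
(* These cofactors delete row 0, the only row depending on [r] or [s]. *)
have cofM r s j : cofactor (M r) ord0 j = cofactor (M s) ord0 j.
  congr (_ * \det _); apply/matrixP => a b.
  by rewrite !mxE !border_lift.
have detMJ k : \det (M (J k)) = 0.
  apply/eqP; apply: contraT => nzk.
  have := dmax d.+1; rewrite ltnn => -> //.
  apply/existsP; exists [ffun i => border k g i].
  apply/existsP; exists [ffun j => border x h j].
  rewrite (_ : mxsub _ _ _ = M (J k)) //.
  apply/matrixP => i j; rewrite !mxE !ffunE /border.
  by case: (unlift ord0 i).
have detM : \det (M w) = 0.
  rewrite (expand_det_row _ ord0).
  transitivity (\sum_k c k * \det (M (J k))); last first.
    by rewrite big1 // => k _; rewrite detMJ mulr0.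
  under [RHS]eq_bigr => k _ do rewrite (expand_det_row _ ord0) mulr_sumr.
  rewrite [RHS]exchange_big; apply: eq_bigr => j _ /=.
  rewrite mxE border0 hw mulr_suml; apply: eq_bigr => k _.
  by rewrite mxE border0 (cofM (J k) w) -mulrA.
(* The expansion along row 0 is solved for its corner term, whose cofactor is the chosen minor. *)
exists (fun j => - cofactor (M w) ord0 (lift ord0 j)).
move: detM; rewrite (expand_det_row _ ord0) big_ord_recl mxE !border0.
have -> : cofactor (M w) ord0 ord0 = \det (mxsub g h J).
  rewrite /cofactor addn0 expr0 mul1r; congr (\det _).
  by apply/matrixP => i j; rewrite !mxE !border_lift.
move/eqP; rewrite addr_eq0 => /eqP->; rewrite -sumrN; apply: eq_bigr => j _.
by rewrite mxE border0 border_lift mulrN.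
Qed.

End Minors.

(** * Lower bound for the product of the factors 1 + X_i *)

Section ProductLowerBound.
Local Open Scope ring_scope.
Variables (R : idomainType) (n : nat).

Definition prod_1X : {mpoly R[n]} := \prod_(i < n) (1 + 'X_i).

Lemma add1X_neq0 i : 1 + 'X_i != 0 :> {mpoly R[n]}.
Proof.
apply/eqP => /(congr1 (mcoeff 0%MM)); rewrite mcoeffD mcoeff1 mcoeffX eqxx.
rewrite mcoeff0 mnm1_eq0 addr0; exact/eqP/oner_neq0.
Qed.

(** The factor 1 + X_x survives differentiation in any other variable. *)
Lemma at_minus1_mderiv_prod_1X x l : l != x ->
  at_minus1 x (prod_1X^`M(l)) = 0.
Proof.
move=> lx; rewrite /prod_1X (bigD1 x) //= mderivM mderivD -mpolyC1 mderivC.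
rewrite mderivX mnm1E eq_sym (negPf lx) scale0r addr0 mul0r add0r mpolyC1.
by rewrite rmorphM rmorphD rmorph1 /= at_minus1X eqxx subrr mul0r.
Qed.

Lemma at_minus1_mderiv_prod_1X_neq0 x :
  at_minus1 x (prod_1X^`M(x)) != 0.
Proof.
rewrite /prod_1X (bigD1 x) //= mderivM mderivD -mpolyC1 mderivC.
rewrite mderivX mnm1E eqxx scale1r -[X in (X - _)%MM]add0m addmK mpolyX0.
rewrite add0r mul1r mpolyC1.
rewrite rmorphD rmorphM /= rmorphD rmorph1 /= at_minus1X eqxx subrr mul0r addr0.
rewrite rmorph_prod; apply/prodf_neq0 => i ix.
by rewrite rmorphD rmorph1 /= at_minus1X (negPf ix) add1X_neq0.
Qed.

Lemma prod_1X_sparsity_bound m (f : 'I_m -> {mpoly R[n]}) (B : nat) :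
  gradient_spanned f prod_1X -> (0 < B)%N ->
  (forall i, (size (msupp (f i)) <= B)%N) ->
  (2 ^ (n - m) <= m`! * B ^ m)%N.
Proof.
move=> [c hc] B0 hB.
have [x|d [g [h [dm nz rel]]]] :=
    @maximal_minor_relation _ m n (jacobian f) c (fun x => prod_1X^`M(x)).
  by rewrite hc; apply: eq_bigr => k _; rewrite mxE.
apply: (@leq_trans (2 ^ #|~: [set h j | j in 'I_d]|)).
  rewrite leq_exp2l // cardsCs setCK card_ord leq_sub2l //.
  by apply: leq_trans (leq_imset_card _ _) _; rewrite card_ord.
apply: leq_trans (size_msupp_vanishing nz _) _ => [x xh|].
  have [e rel_x] := rel x.
  have : at_minus1 x (\sum_j prod_1X^`M(h j) * e j) = 0.
    rewrite rmorph_sum big1 // => j _.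
    rewrite rmorphM /= at_minus1_mderiv_prod_1X ?mul0r //.
    by apply: contraTneq xh => <-; rewrite inE negbK imset_f.
  rewrite -rel_x rmorphM /= => /eqP.
  by rewrite mulf_eq0 (negPf (at_minus1_mderiv_prod_1X_neq0 x)) => /eqP.
apply: leq_trans (size_msupp_det (B := B) _) _ => [i j|].
  by rewrite !mxE; apply: leq_trans (size_msupp_mderiv _ _) (hB _).
by rewrite leq_mul ?leq_pexp2l // leq_fact.
Qed.

End ProductLowerBound.

(** * Permanents of Hessenberg matrices *)

Section HessenbergPermanent.
Local Open Scope ring_scope.
Variable R : comPzRingType.

(** A permutation is determined by the image of 0 and the permutation induced on the remaining
    points; counting then gives surjectivity. *)
Lemma lift_perm0_bij n :
  bijective (fun u : 'I_n.+1 * 'S_n => lift_perm ord0 u.1 u.2).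
Proof.
apply: inj_card_bij => [[j s] [j' s'] /= /permP e|]; last first.
  by rewrite card_prod !card_Sn card_ord factS.
have := e ord0; rewrite !lift_perm_id => ej; rewrite -{j'}ej in e *.
congr (_, _); apply/permP => i; apply: (@lift_inj _ j).
by rewrite -!(lift_perm_lift ord0) e.
Qed.

Lemma permanent_expand_row0 n (A : 'I_n.+1 -> 'I_n.+1 -> R) :
  \sum_(s : 'S_n.+1) \prod_i A i (s i) =
  \sum_j A ord0 j *
    \sum_(s : 'S_n) \prod_i A (lift ord0 i) (lift j (s i)).
Proof.
rewrite (reindex _ (onW_bij _ (lift_perm0_bij n))) /=.
under [RHS]eq_bigr => j _ do rewrite mulr_sumr.
rewrite pair_bigA; apply: eq_bigr => -[j s] _ /=.
rewrite big_ord_recl lift_perm_id; congr (_ * _).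
by apply: eq_bigr => i _; rewrite lift_perm_lift.
Qed.

(** Natural-number indices make the minors of the row expansion matrices of the same shape with [y]
    shifted by one. *)
Definition hessenberg (y : nat -> R) (i j : nat) : R :=
  if (j <= i)%N then 1 else if j == i.+1 then y i else 0.

(* Below the first row, columns 0 and 1 are both constantly 1: the two
   nonzero terms of the expansion along the first row have the same minor. *)
Lemma permanent_hessenberg n (y : nat -> R) :
  \sum_(s : 'S_n.+1) \prod_(i < n.+1) hessenberg y i (s i) =
  \prod_(i < n) (1 + y i).
Proof.
elim: n y => [|n IH] y;
  rewrite (permanent_expand_row0 (fun i j => hessenberg y i j)).
  rewrite big_ord1 big_ord0 /hessenberg /= mul1r.
  by under eq_bigr do rewrite big_ord0; rewrite sumr_const card_Sn.
rewrite [LHS]big_ord_recl [X in _ + X]big_ord_recl [X in _ + (_ + X)]big1;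
  last by move=> j _; rewrite /hessenberg /= mul0r.
rewrite addr0 [RHS]big_ord_recl mulrDl.
have minorE (j : 'I_n.+2) : (j <= 1)%N ->
    \sum_(s : 'S_n.+1) \prod_(i < n.+1)
      hessenberg y (lift ord0 i) (lift j (s i)) = \prod_(i < n) (1 + y i.+1).
  move=> j1; rewrite -(IH (fun i => y i.+1)); apply: eq_bigr => s _.
  apply: eq_bigr => i _; rewrite /hessenberg /= /bump leq0n add1n.
  case: j j1 => [[|[|]]] //= _ _.
  by case: (nat_of_ord (s i)).
by rewrite !minorE // /hessenberg.
Qed.

End HessenbergPermanent.

(** * From the permanent to the product *)

Section PermanentSubstitution.
Local Open Scope ring_scope.
Variable n : nat.

(** The default 0 is never read in a matrix of size [n.+1]: an entry above the diagonal in column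
    [i.+1] has [i < n]. *)
Definition nat_var (i : nat) : {mpoly int[n]} :=
  oapp (fun j : 'I_n => 'X_j) 0 (insub i).

Lemma nat_var_ord (i : 'I_n) : nat_var i = 'X_i.
Proof. by rewrite /nat_var valK. Qed.

Definition hessenberg_subst (e : 'I_(n.+1 * n.+1)) : {mpoly int[n]} :=
  mxvec (\matrix_(i < n.+1, j < n.+1) hessenberg nat_var i j) ord0 e.

Lemma size_msupp_hessenberg_subst e :
  (size (msupp (hessenberg_subst e)) <= 1)%N.
Proof.
case/mxvec_indexP: e => i j; rewrite /hessenberg_subst mxvecE mxE /hessenberg.
case: ifP => _; first by rewrite size_msupp1.
case: ifP => _; last by rewrite -mpolyC0 msupp0.
by rewrite /nat_var; case: insub => [x|] /=; rewrite ?msuppX // -mpolyC0 msupp0.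
Qed.

Lemma PER_hessenberg_subst :
  mmap (@mpolyC n int) hessenberg_subst (PER n.+1) = prod_1X int n.
Proof.
rewrite /PER rmorph_sum /= /prod_1X.
under [RHS]eq_bigr => i _ do rewrite -nat_var_ord.
rewrite -permanent_hessenberg; apply: eq_bigr => s _.
rewrite rmorph_prod; apply: eq_bigr => i _ /=.
by rewrite mmapX mmap1U /hessenberg_subst mxvecE mxE.
Qed.

End PermanentSubstitution.

(** * Polynomial against exponential growth, and the conclusion *)

Lemma linear_lt_exp2 a b : exists u, a + u * b < 2 ^ u.
Proof.
(* For [u = 2 * v], the power is the square of [2 ^ v], hence at least [v.+1 ^ 2], which exceeds
   [a + 2 * v * b] because [2 * b <= v] and [a <= v]. *)
exists (2 * (a + 2 * b)); set v := a + 2 * b.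
have lt_v : v < 2 ^ v by exact: ltn_expl.
rewrite [X in 2 ^ X]mulnC expnM; apply: (@leq_trans (v.+1 ^ 2));
  last by rewrite leq_exp2r.
by rewrite -mulnn /v; nia.
Qed.

Lemma horner_lt_exp2 (p : {poly int}) :
  exists2 n : nat, (0 < n)%N & (p.[n%:Z] < (2 ^ n)%:Z)%R.
Proof.
pose C := \sum_(i < size p) `|(p`_i)%R|%N.
have [u lt_u] := linear_lt_exp2 C (size p).
(* At a power of two, the bound [C * n ^ size p] is at most 2 to an exponent linear in [u]. *)
exists (2 ^ u); first by rewrite expn_gt0.
apply: (@le_lt_trans _ _ (C * (2 ^ u) ^ size p)%:Z%R).
  rewrite horner_coef /C big_distrl /= (big_morph Posz PoszD (erefl _)).
  apply: ler_sum => i _; rewrite PoszM; apply: (le_trans (ler_norm _)).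
  rewrite normrM abszE ler_wpM2l // normrX -!natz normr_nat -natrX.
  by rewrite ler_nat leq_pexp2l ?expn_gt0 // ltnW.
rewrite ltz_nat -expnM; apply: (@leq_ltn_trans (2 ^ C * 2 ^ (u * size p))).
  by rewrite leq_mul // ltnW // ltn_expl.
by rewrite -expnD ltn_exp2l.
Qed.

Theorem theorem3 (k m : nat) (hk : 0 < k) (hm : 0 < m) :
  ~ mSPS k m PER.
Proof.
case=> Q hQ.
(* The factor [2 ^ m.+1] pays for the gap between [2 ^ n.+1] and the lower bound [2 ^ (n - m)], also
   when the subtraction truncates. *)
pose T := (((m`! * 2 ^ m.+1)%:R : int) *: Q ^+ m)%R.
have [[//|n] _ ltT] := horner_lt_exp2 T.
have [f [alpha [_ PERE hbit hf]]] := hQ n.+1 isT.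
(* A bitsize is at least 1, and an exponent exists because [k] and [m] are positive. *)
have Q_ge1 : (1 <= Q.[Posz n.+1])%R.
  by apply: le_trans (hbit (Ordinal hk) (Ordinal hm)).
have [B QB] : exists B : nat, Q.[Posz n.+1]%R = Posz B.
  by case: (Q.[_])%R Q_ge1 => // B; exists B.
have B0 : 0 < B by rewrite QB in Q_ge1.
pose f' j := mmap (@mpolyC n int) (@hessenberg_subst n) (f j).
have spanned : gradient_spanned f' (prod_1X int n).
  rewrite -PER_hessenberg_subst PERE rmorph_sum.
  under eq_bigr => i _ do rewrite rmorph_prod; rewrite /=.
  under eq_bigr => i _ do under eq_bigr => j _ do rewrite rmorphXn.
  exact: gradient_spanned_sum_prod.
have sparse_f' j : size (msupp (f' j)) <= B.
  apply: leq_trans (size_msupp_subst _ (@size_msupp_hessenberg_subst n)) _.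
  by have [_] := hf j; rewrite /sparse QB lez_nat.
have := prod_1X_sparsity_bound spanned B0 sparse_f'.
apply/negP; rewrite -ltnNge.
move: ltT; rewrite /T hornerZ horner_exp QB.
rewrite -!natz -natrX -natrM ltr_nat => ltT.
rewrite -(ltn_pmul2r (expn_gt0 2 m.+1)).
apply: (@leq_trans (2 ^ n.+1)); last first.
  by rewrite -expnD leq_exp2l //; lia.
by rewrite mulnAC.
Qed.
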